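(* Let $k$ be an algebraically closed field of characteristic $p>0$ and let $(\mathfrak{g},[p])$ be a finite-dimensional restricted Lie algebra over $k$ such that $V(\mathfrak{g})=\{x\in\mathfrak{g} : x^{[p]}=0\}$ is a subspace of $\mathfrak{g}$. Let $M$ be a finite-dimensional $U_0(\mathfrak{g})$-module. Then \[ \deg^j(M)\in\{0,\ldots,j\,\mathrm{rk}^j(M)\}\] for every $j\in\{1,\ldots,p-1\}$.
   Context: $U_0(\mathfrak{g})=U(\mathfrak{g})/(\{x^p-x^{[p]} : x\in\mathfrak{g}\})$ is the restricted enveloping algebra. For $x\in\mathfrak{g}$, $x_M:M\to M$ is the operator $m\mapsto x.m$. The generic $j$-rank is $\mathrm{rk}^j(M)=\max\{\mathrm{rk}(x_M^j) : x\in V(\mathfrak{g})\}$. Degree of a morphism: if $U\subseteq\mathbb{P}^n$ is non-empty open and $\varphi:U\to\mathbb{P}^m$ is a morphism, there are homogeneous polynomials $f_0,\ldots,f_m\in k[X_0,\ldots,X_n]$ of the same degree $d$ with $\gcd(f_0,\ldots,f_m)=1$ and $\varphi(x)=(f_0(x):\cdots:f_m(x))$ for all $x\in U$; they are unique up to a common non-zero scalar, and $\deg(\varphi):=d$. Degree of a module: let $d_j=\mathrm{rk}^j(M)$. The set $U_{M,j}=\{[x]\in\mathbb{P}(V(\mathfrak{g})) : \mathrm{rk}(x_M^j)=d_j\}$ is open, and $\mathrm{im}^j_M:U_{M,j}\to\mathrm{Gr}_{d_j}(M)$, $[x]\mapsto\mathrm{im}\,x_M^j$, is a morphism to the Grassmannian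 of $d_j$-dimensional subspaces of $M$. Let $\mathrm{pl}_M:\mathrm{Gr}_{d_j}(M)\to\mathbb{P}(\bigwedge^{d_j}M)$ be the Plücker embedding. The $j$-degree is $\deg^j(M):=\deg(\mathrm{pl}_M\circ\mathrm{im}^j_M)$ if $d_j>0$, and $\deg^j(M):=0$ if $d_j=0$. *)

(* Defs.v *)
From HB Require Import structures.
From mathcomp Require Import all_boot all_order all_algebra.
From mathcomp Require Import perm generic_quotient ring_quotient.
From mathcomp Require Import boolp classical_sets.
From mathcomp.multinomials Require Import mpoly.
From mathcomp.multinomials Require monalg.

Set Implicit Arguments.
Unset Strict Implicit.
Unset Printing Implicit Defensive.

Import GRing.Theory.

Local Open Scope ring_scope.
Local Open Scope quotient_scope.

(* mathcomp's ring quotients are commutative and non-zero; the restricted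
   enveloping algebra needs quotients by arbitrary two-sided ideals. *)
Section IdealQuotient.
Variables (A : pzRingType) (S : A -> Prop).

Inductive two_sided_ideal : A -> Prop :=
| two_sided_ideal_gen a s b : S s -> two_sided_ideal (a * s * b)
| two_sided_ideal0 : two_sided_ideal 0
| two_sided_idealB x y :
    two_sided_ideal x -> two_sided_ideal y -> two_sided_ideal (x - y).

Definition ideal_pred : pred A := fun x => `[< two_sided_ideal x >].

Fact ideal_zmod_closed : zmod_closed ideal_pred.
Proof.
split=> [|x y]; first exact/asboolP/two_sided_ideal0.
by move=> /asboolP xI /asboolP yI; apply/asboolP/two_sided_idealB.
Qed.
HB.instance Definition _ :=
  GRing.isZmodClosed.Build A ideal_pred ideal_zmod_closed.

Fact ideal_mulL a x : x \in ideal_pred -> a * x \in ideal_pred.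
Proof.
move=> /asboolP xI; apply/asboolP.
elim: xI => [b s c Ss||y z _ yI _ zI].
- by rewrite !mulrA; apply: two_sided_ideal_gen.
- by rewrite mulr0; apply: two_sided_ideal0.
- by rewrite mulrBr; apply: two_sided_idealB.
Qed.

Fact ideal_mulR a x : x \in ideal_pred -> x * a \in ideal_pred.
Proof.
move=> /asboolP xI; apply/asboolP.
elim: xI => [b s c Ss||y z _ yI _ zI].
- by rewrite -mulrA; apply: two_sided_ideal_gen.
- by rewrite mul0r; apply: two_sided_ideal0.
- by rewrite mulrBl; apply: two_sided_idealB.
Qed.

Definition ideal_zmod : zmodClosed A := GRing.ZmodClosed.clone A ideal_pred _.

Definition ring_quot := Quotient.quot ideal_zmod.
HB.instance Definition _ := GRing.Zmodule.on ring_quot.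

Definition quot_one : ring_quot := \pi_(Quotient.quot ideal_zmod) 1.
Definition quot_mul (x y : ring_quot) : ring_quot :=
  \pi_(Quotient.quot ideal_zmod)
    (repr (x : Quotient.quot ideal_zmod) * repr (y : Quotient.quot ideal_zmod)).

Definition quot_pi (a : A) : ring_quot := \pi_(Quotient.quot ideal_zmod) a.

Fact quot_pi_surj (x : ring_quot) : exists a, x = quot_pi a.
Proof.
by exists (repr (x : Quotient.quot ideal_zmod)); rewrite /quot_pi reprK.
Qed.

Fact quot_pi_eq a b : a - b \in ideal_pred -> quot_pi a = quot_pi b.
Proof. by rewrite Quotient.idealrBE => /eqP. Qed.

Fact quot_pi_repr a :
  repr (quot_pi a : Quotient.quot ideal_zmod) - a \in ideal_pred.
Proof. by rewrite Quotient.idealrBE reprK. Qed.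

Fact quot_piD a b : quot_pi (a + b) = quot_pi a + quot_pi b.
Proof. exact: Quotient.pi_add. Qed.

Fact quot_piM a b : quot_pi (a * b) = quot_mul (quot_pi a) (quot_pi b).
Proof.
apply/esym/quot_pi_eq.
rewrite -[X in X - _](addrNK (repr (quot_pi a : Quotient.quot ideal_zmod) * b)).
rewrite -mulrBr -addrA -mulrBl rpredD //.
  exact/ideal_mulL/quot_pi_repr.
exact/ideal_mulR/quot_pi_repr.
Qed.

Fact quot_mulA : associative quot_mul.
Proof.
move=> x y z; have [[a ->] [b ->] [c ->]] :=
  And3 (quot_pi_surj x) (quot_pi_surj y) (quot_pi_surj z).
by rewrite -!quot_piM mulrA.
Qed.

Fact quot_mul1l : left_id quot_one quot_mul.
Proof. by move=> x; have [a ->] := quot_pi_surj x; rewrite -quot_piM mul1r. Qed.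

Fact quot_mul1r : right_id quot_one quot_mul.
Proof. by move=> x; have [a ->] := quot_pi_surj x; rewrite -quot_piM mulr1. Qed.

Fact quot_mulDl : left_distributive quot_mul +%R.
Proof.
move=> x y z; have [[a ->] [b ->] [c ->]] :=
  And3 (quot_pi_surj x) (quot_pi_surj y) (quot_pi_surj z).
by rewrite -quot_piD -!quot_piM mulrDl quot_piD.
Qed.

Fact quot_mulDr : right_distributive quot_mul +%R.
Proof.
move=> x y z; have [[a ->] [b ->] [c ->]] :=
  And3 (quot_pi_surj x) (quot_pi_surj y) (quot_pi_surj z).
by rewrite -quot_piD -!quot_piM mulrDr quot_piD.
Qed.

HB.instance Definition _ := GRing.Zmodule_isPzRing.Build ring_quot
  quot_mulA quot_mul1l quot_mul1r quot_mulDl quot_mulDr.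

Fact quot_pi_zmod_morphism : zmod_morphism quot_pi.
Proof.
move=> a b; apply: (@addIr _ (quot_pi b)).
by rewrite -quot_piD !subrK.
Qed.
HB.instance Definition _ :=
  GRing.isZmodMorphism.Build A ring_quot quot_pi quot_pi_zmod_morphism.

Fact quot_pi_monoid_morphism : monoid_morphism quot_pi.
Proof. by split=> // a b; apply: quot_piM. Qed.
HB.instance Definition _ :=
  GRing.isMonoidMorphism.Build A ring_quot quot_pi quot_pi_monoid_morphism.

Lemma quot_pi_rel a b : S (a - b) -> quot_pi a = quot_pi b.
Proof.
move=> Sab; apply/quot_pi_eq/asboolP.
by rewrite -[a - b]mul1r -[1 * _]mulr1; apply: two_sided_ideal_gen.
Qed.

End IdealQuotient.

(* The coefficient of t^i in ad(t x + y)^n (x), computed in g (x) k[t]. *)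
Fixpoint ad_coef (G : zmodType) (br : G -> G -> G) (x y : G) (n i : nat) : G :=
  if n is n'.+1 then
    (if i is i'.+1 then br x (ad_coef br x y n' i') else 0)
      + br y (ad_coef br x y n' i)
  else if i is 0%N then x else 0.

(* In [pth_mapD], i * s_i(x, y) is the coefficient of t^(i-1) in
   ad(t x + y)^(p-1) (x), for 1 <= i <= p - 1. *)
Record restrictedLie (k : fieldType) (p : nat) (g : vectType k) :=
  RestrictedLie {
  bracket : g -> g -> g;
  pth_map : g -> g;
  bracketDl : forall x y z, bracket (x + y) z = bracket x z + bracket y z;
  bracketDr : forall x y z, bracket x (y + z) = bracket x y + bracket x z;
  bracketZl : forall a x y, bracket (a *: x) y = a *: bracket x y;
  bracketZr : forall a x y, bracket x (a *: y) = a *: bracket x y;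
  bracketxx : forall x, bracket x x = 0;
  jacobi : forall x y z, bracket x (bracket y z) + bracket y (bracket z x)
                         + bracket z (bracket x y) = 0;
  ad_pth_map : forall x y, bracket (pth_map x) y = iter p (bracket x) y;
  pth_mapZ : forall a x, pth_map (a *: x) = a ^+ p *: pth_map x;
  pth_mapD : forall x y, pth_map (x + y) = pth_map x + pth_map y
    + \sum_(1 <= i < p) (i%:R)^-1 *: ad_coef bracket x y p.-1 i.-1
}.

Section RestrictedEnveloping.
(* Imported only here: its {mpoly _} is not the type of that name in mpoly.v. *)
Import monalg.
Variables (k : fieldType) (p : nat) (g : vectType k) (L : restrictedLie p g).

Local Notation free_alg := {malg k[{fmonom g}]}.
Definition free_gen (x : g) : free_alg := << fmu x >>.

(* The first two relations make [free_alg] into the tensor algebra of g. *)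
Inductive lie_rel : free_alg -> Prop :=
| lie_relD x y : lie_rel (free_gen (x + y) - (free_gen x + free_gen y))
| lie_relZ a x : lie_rel (free_gen (a *: x) - a *: free_gen x)
| lie_rel_bracket x y : lie_rel
    (free_gen x * free_gen y - free_gen y * free_gen x
     - free_gen (bracket L x y)).

Definition enveloping : pzRingType := ring_quot lie_rel.
Definition env_gen (x : g) : enveloping := quot_pi lie_rel (free_gen x).

Inductive p_rel : enveloping -> Prop :=
| p_rel_gen x : p_rel (env_gen x ^+ p - env_gen (pth_map L x)).

Definition restricted_env : pzRingType := ring_quot p_rel.

Definition renv_gen (x : g) : restricted_env := quot_pi p_rel (env_gen x).
Definition renv_scalar (a : k) : restricted_env :=
  quot_pi p_rel (quot_pi lie_rel (a *: 1)).

(* A module over the k-algebra U_0(g) on the finite-dimensional k-space M,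
   i.e. a homomorphism of k-algebras U_0(g) -> End_k(M). It is spelled out
   because the product of the library's ring 'End(M) is reversed composition. *)
Record renv_module (M : vectType k) := RenvModule {
  act : restricted_env -> 'End(M);
  actD : forall u v, act (u + v) = act u + act v;
  act1 : act 1 = \1%VF;
  actM : forall u v, act (u * v) = (act u \o act v)%VF;
  act_scalar : forall a, act (renv_scalar a) = a *: \1%VF
}.

End RestrictedEnveloping.

(* d-dimensional subspaces of W; the projective space P(W) is [Gr 1 W]. *)
Definition Gr (k : fieldType) (d : nat) (W : vectType k) :=
  {U : {vspace W} | \dim U == d}.
Definition mkGr (k : fieldType) (d : nat) (W : vectType k) (U : {vspace W})
  (dimU : \dim U == d) : Gr d W := exist (fun U => \dim U == d) U dimU.

Section ExteriorPower.
Variables (k : fieldType) (d : nat) (M : vectType k).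

Local Notation n := (\dim {:M}).

(* The exterior power has the basis e_I = e_(i_1) /\ ... /\ e_(i_d), for
   I = {i_1 < ... < i_d}, where e = vbasis {:M}; it is modelled by the
   coordinates in that basis, and those of v_1 /\ ... /\ v_d are the
   d-minors of the coordinate matrix of v. *)
Definition ext_index := {I : {set 'I_n} | #|I| == d}.
Definition ext_power := {ffun ext_index -> k^o}.

Definition ext_col (I : ext_index) (b : 'I_d) : 'I_n :=
  enum_val (cast_ord (esym (eqP (valP I))) b).

Definition wedge (v : 'I_d -> M) : ext_power :=
  [ffun I => \det (\matrix_(a, b) coord (vbasis {:M}) (ext_col I b) (v a))].

Lemma ext_col_inj (I : ext_index) : injective (ext_col I).
Proof. by move=> a b /enum_val_inj /cast_ord_inj. Qed.

Lemma mem_ext_col (I : ext_index) i : (i \in val I) = [exists b, ext_col I b == i].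
Proof.
apply/idP/existsP => [iI|[b /eqP <-]]; last exact: enum_valP.
exists (cast_ord (eqP (valP I)) (enum_rank_in iI i)).
by rewrite /ext_col cast_ordK enum_rankK_in.
Qed.

Lemma wedge_lin (v : 'I_d -> M) (a0 : 'I_d) (c : k) (x y : M) :
  wedge [eta v with a0 |-> c *: x + y]
  = c *: wedge [eta v with a0 |-> x] + wedge [eta v with a0 |-> y].
Proof.
apply/ffunP => I; rewrite !ffunE.
set A := \matrix_(_, _) _; set B := \matrix_(_, _) _; set C := \matrix_(_, _) _.
rewrite -[\det C]mul1r; apply: (@determinant_multilinear _ _ A B C a0).
- by apply/rowP => b; rewrite !mxE /= eqxx linearP mul1r.
- apply/matrixP => a b; rewrite !mxE /=.
  by rewrite eq_sym (negbTE (neq_lift _ _)).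
- apply/matrixP => a b; rewrite !mxE /=.
  by rewrite eq_sym (negbTE (neq_lift _ _)).
Qed.

Lemma wedge_alt (v : 'I_d -> M) (a b : 'I_d) :
  a != b -> v a = v b -> wedge v = 0.
Proof.
move=> ab vab; apply/ffunP => I; rewrite !ffunE.
by apply: (determinant_alternate ab) => c; rewrite !mxE vab.
Qed.

Lemma wedge_basis (I J : ext_index) :
  wedge (fun a => (vbasis {:M})`_(ext_col I a)) J = (I == J)%:R.
Proof.
have fM : free (vbasis {:M}) by exact/basis_free/vbasisP.
rewrite ffunE; have [<-|IJ] := eqVneq.
  rewrite -[RHS](det1 _ d); congr (\det _); apply/matrixP => a b.
  by rewrite !mxE coord_free // (inj_eq (@ext_col_inj I)) eq_sym.
have /subsetPn [i iI iJ] : ~~ (val I \subset val J).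
  apply: contra IJ => sIJ; apply/eqP/val_inj/eqP.
  by rewrite eqEcard sIJ (eqP (valP I)) (eqP (valP J)) leqnn.
move: iI; rewrite mem_ext_col => /existsP [a /eqP ai].
rewrite (expand_det_row _ a) big1 // => b _.
rewrite !mxE coord_free // ai; case: eqP => [E|_]; last by rewrite mul0r.
by case/negP: iJ; rewrite mem_ext_col; apply/existsP; exists b; rewrite E.
Qed.

Lemma wedge_neq0 (v : 'I_d -> M) :
  (forall c : 'I_d -> k, \sum_a c a *: v a = 0 -> forall a, c a = 0) ->
  wedge v != 0.
Proof.
move=> vfree; set e := vbasis {:M}.
pose A : 'M[k]_(d, n) := \matrix_(a, b) coord e b (v a).
have rkA : row_full A^T.
  rewrite -col_leq_rank mxrank_tr; have : row_free A; last by move/eqP->.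
  apply/row_freeP; apply: contrapT => nfree.
  have /rowV0Pn [u /sub_kermxP uA u0] : kermx A != 0.
    by apply: contra_notN nfree; rewrite kermx_eq0 => /row_freeP.
  case/negP: u0; apply/eqP/rowP => a; rewrite [RHS]mxE.
  apply: (vfree (fun a => u 0 a)).
  rewrite [LHS](coord_vbasis (memvf _)) big1 // => b _.
  have -> : coord e b (\sum_a u 0 a *: v a) = (u *m A) 0 b.
    by rewrite linear_sum mxE; apply: eq_bigr => c _; rewrite linearZ mxE.
  by rewrite uA mxE scale0r.
pose f := fullrankfun rkA.
have finj : injective f by exact: fullrankfun_inj.
have cI : #|[set f b | b : 'I_d]| == d by rewrite card_imset // card_ord.
pose I : ext_index := exist (fun I : {set _} => #|I| == d) _ cI.
have /fin_all_exists [h hE] (b : 'I_d) : exists c, f c = ext_col I b.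
  have /imsetP [c _ ->] : ext_col I b \in [set f b | b : 'I_d].
    exact: enum_valP.
  by exists c.
have hinj : injective h.
  by move=> b c E; apply: (@ext_col_inj I); rewrite -!hE E.
have fu : row_full (rowsub f A^T) by exact: fullrowsub_full.
pose B : 'M[k]_d := \matrix_(a, b) coord e (ext_col I b) (v a).
have Bu : B \in unitmx.
  rewrite -unitmx_tr (_ : B^T = row_perm (perm hinj) (rowsub f A^T)).
    by rewrite row_permE unitmx_mul unitmx_perm -row_full_unit.
  by apply/matrixP => b a; rewrite !mxE permE hE.
apply/eqP => /ffunP/(_ I); rewrite !ffunE => detB0.
by move: Bu; rewrite unitmxE [\det B]detB0 unitr0.
Qed.

Lemma wedge_vbasis_dim (U : Gr d M) :
  \dim <[wedge (fun a => (vbasis (val U))`_a)]>%VS == 1%N.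
Proof.
rewrite dim_vline wedge_neq0 // => c c0 a.
have /freeP fU : free (vbasis (val U)) by exact/basis_free/vbasisP.
have dU := eqP (valP U).
rewrite -[a](cast_ordKV dU); apply: (fU (fun i => c (cast_ord dU i))).
rewrite -[RHS]c0 [RHS](reindex (cast_ord dU)) //=.
by exists (cast_ord (esym dU)) => ? _; rewrite (cast_ordK, cast_ordKV).
Qed.

Definition plucker (U : Gr d M) : Gr 1 ext_power :=
  mkGr (wedge_vbasis_dim U).

End ExteriorPower.

Section MorphismDegree.
Variables (k : fieldType) (W E : vectType k) (D : pred (Gr 1 W)).
Variable (phi : {x | D x} -> Gr 1 E).

Local Notation n := (\dim {:W}).
Local Notation m := (\dim {:E}).

Definition gcd_one (f : 'I_m -> {mpoly k[n]}) :=
  forall h, (forall i, exists q, f i = h * q) -> h \is a GRing.unit.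

(* The homogeneous coordinates of [w] in P(W) and of points of P(E) are the
   coordinates in vbasis {:W} and vbasis {:E}. As phi takes its values among
   lines, the last clause forces the (f i)(w) not to vanish simultaneously. *)
Definition is_degree (d : nat) := exists f : 'I_m -> {mpoly k[n]},
  [/\ forall i, f i \is d.-homog,
      gcd_one f
    & forall (x : {x | D x}) (w : W), val (val x) = <[w]>%VS ->
        val (phi x) = <[\sum_i (f i).@[fun a => coord (vbasis {:W}) a w]
                                *: (vbasis {:E})`_i]>%VS].

(* The default 0 is never used for a morphism on a non-empty open set: there
   such a d exists and is unique. *)
Definition degree : nat := xget 0%N [set d | is_degree d]%classic.

End MorphismDegree.

Section ModuleDegree.
Variables (k : fieldType) (p : nat) (g : vectType k) (L : restrictedLie p g).
Variables (M : vectType k) (X : renv_module L M).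

Definition nullcone : set g := [set x | pth_map L x = 0]%classic.

Definition mod_op (x : g) : 'End(M) := act X (renv_gen L x).
Definition mod_pow (j : nat) (x : g) : 'End(M) :=
  iter j (fun f => (mod_op x \o f)%VF) \1%VF.

Definition rk (f : 'End(M)) : nat := \dim (limg f).

Definition generic_rank (j : nat) : nat :=
  \max_(r < (\dim {:M}).+1 | `[< exists2 x, nullcone x & rk (mod_pow j x) = r >])
     r.

Variable V : {vspace g}.

Definition proj_rep (l : Gr 1 (subvs_of V)) : g := vsval (vpick (val l)).

Definition max_locus (j : nat) : pred (Gr 1 (subvs_of V)) :=
  fun l => rk (mod_pow j (proj_rep l)) == generic_rank j.

Definition image_map (j : nat) (l : {l | max_locus j l}) :
  Gr (generic_rank j) M :=
  @mkGr _ _ _ (limg (mod_pow j (proj_rep (val l)))) (valP l).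

(* Meant for V with underlying set [nullcone]. *)
Definition module_degree (j : nat) : nat :=
  if generic_rank j == 0%N then 0%N
  else degree (fun l => plucker (@image_map j l)).

End ModuleDegree.

(* Main.v *)
From HB Require Import structures.
Require Import Defs.
From mathcomp Require Import all_boot all_order all_algebra.
From mathcomp Require Import boolp classical_sets.
From mathcomp.multinomials Require Import mpoly.
From mathcomp.multinomials Require monalg.

(* In coordinates, x_M^j is a matrix of homogeneous forms of degree j in
   x \in V(g). Fix x_0 of maximal rank r = rk^j(M) and v_1, ..., v_r in M whose
   images under x_0^j are independent: the coordinates F of
   x^j v_1 /\ ... /\ x^j v_r are forms of degree j r, not all zero, and
   represent the Pluecker point of im x^j wherever they do not all vanish. If f
   is a representation of that map by coprime forms of degree d, then
   f_a F_b = f_b F_a at all points, hence as polynomials; since k[X_1, ..., X_n]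
   is factorial, F = h f for some h, so d <= j r. *)

Set Implicit Arguments.
Unset Strict Implicit.
Unset Printing Implicit Defensive.

Import GRing.Theory.
Local Open Scope ring_scope.

(** * Divisibility and prime factorizations in an integral domain *)

Section Factorial.
Variable R : idomainType.
Implicit Types a b c p u : R.

Definition divides a b := exists c, b = c * a.

Definition prime_elt p :=
  [/\ p != 0, p \isn't a GRing.unit
    & forall a b, divides p (a * b) -> divides p a \/ divides p b].

Inductive prime_product : R -> Prop :=
| prime_product_unit u : u \is a GRing.unit -> prime_product u
| prime_product_mul p a :
    prime_elt p -> prime_product a -> prime_product (p * a).

Lemma divides_trans a b c : divides a b -> divides b c -> divides a c.
Proof. by move=> [x ->] [y ->]; exists (y * x); rewrite mulrA. Qed.

Lemma divides_mull a b c : divides a b -> divides a (c * b).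
Proof. by move=> [x ->]; exists (c * x); rewrite mulrA. Qed.

Lemma prime_productM a b :
  prime_product a -> prime_product b -> prime_product (a * b).
Proof.
move=> aP bP; elim: aP => [u uU|p c pP _ IH]; last first.
  by rewrite -mulrA; apply: prime_product_mul.
elim: bP => [v vU|p c pP _ IH].
  by apply: prime_product_unit; rewrite unitrM uU.
by rewrite mulrCA; apply: prime_product_mul.
Qed.

Lemma prime_not_dvd_unit p u :
  prime_elt p -> u \is a GRing.unit -> ~ divides p u.
Proof.
move=> [_ pU _] uU [c E]; move: uU; rewrite E unitrM => /andP[_ pU'].
by rewrite pU' in pU.
Qed.

(** Primes are irreducible: if [q = c * p], then [q] divides [c] or [p], and the first would make
    [p] a unit. *)
Lemma prime_divides_sym p q : prime_elt p -> prime_elt q ->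
  divides p q -> divides q p.
Proof.
move=> [p0 pU _] [q0 qU qP] [c E].
case: (qP c p); [by exists 1; rewrite mul1r -E| |by []].
move=> [e ec]; case/negP: pU; apply/unitrP; exists e.
suff ep1 : e * p = 1 by rewrite [p * e]mulrC.
by apply: (mulfI q0); rewrite mulr1 {2}E ec mulrA [q * e]mulrC.
Qed.

(** Factorizations into primes, as opposed to irreducibles, are automatically unique up to units, so
    existence is all that has to be required. *)
Definition factorial_ring := forall a, a != 0 -> prime_product a.

End Factorial.

(* Every prime factor of [a] misses some [f i], hence divides [b]. *)
Lemma coprime_family_divides (R : idomainType) (I : Type) (f F : I -> R) a b :
    (forall h, (forall i, divides h (f i)) -> h \is a GRing.unit) ->
  prime_product a -> (forall i, a * F i = f i * b) -> divides a b.
Proof.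
move=> f1 aP; elim: aP b => [u uU b _|p {}a pP _ IH b E].
  by exists (b * u^-1); rewrite mulrVK.
have [p0 pU pprime] := pP.
have [i pfi] : exists i, ~ divides p (f i).
  by apply/existsNP => /f1; apply/negP.
have : divides p (f i * b).
  by rewrite -E; exists (a * F i); rewrite -mulrA [RHS]mulrC.
case/pprime => // -[c bE]; case: (IH c) => [i'|d cE].
  by apply: (mulfI p0); rewrite mulrA E bE mulrA [RHS]mulrC.
by exists d; rewrite bE cE -mulrA [a * p]mulrC.
Qed.

(** * Gauss's lemma: R[X] is factorial if R is *)

Section GaussLemma.
Variable R : idomainType.
Hypothesis Rfact : factorial_ring R.
Implicit Types (c u v l : R) (p q h a b : {poly R}).

(** If R is a field, it has no primes and even 0 is primitive, whence the separate conditions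
    [p != 0] below. *)
Definition primitive_poly p := forall c, prime_elt c -> ~ divides c%:P p.

Lemma polyC_divides c p : divides c%:P p <-> forall i, divides c p`_i.
Proof.
split=> [[q ->] i|cp]; first by exists q`_i; rewrite coefMC.
have /choice [d dE] : forall i, exists d, p`_i = d * c by [].
exists (\poly_(i < size p) d i); apply/polyP => i; rewrite coefMC coef_poly.
by case: ltnP => // ?; rewrite mul0r nth_default.
Qed.

(** If c divides neither p nor q, let p_i and q_j be their first coefficients not divisible by c. In
    the coefficient of index i + j of p q all other terms are divisible by c, hence so is p_i q_j, a
    contradiction. *)
Lemma prime_polyC c : prime_elt c -> prime_elt c%:P.
Proof.
move=> [c0 cU cP]; split; first by rewrite polyC_eq0.
  by rewrite poly_unitE coefC eqxx (negbTE cU) andbF.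
move=> p q cpq; apply: contrapT => /not_orP[np nq].
have first_bad r : ~ divides c%:P r -> exists i, ~ divides c r`_i /\
    forall m, (m < i)%N -> divides c r`_m.
  move=> nr; have ex : exists i, `[< ~ divides c r`_i >].
    apply: contrapT => nex; apply: nr; apply/polyC_divides => i.
    by apply: contrapT => ni; apply: nex; exists i; apply/asboolP.
  exists (ex_minn ex); case: ex_minnP => i /asboolP ni imin; split=> // m mi.
  by apply: contrapT => /asboolP /imin; rewrite leqNgt mi.
have [i [npi pi]] := first_bad p np; have [j [nqj qj]] := first_bad q nq.
have := (polyC_divides c (p * q)).1 cpq (i + j)%N.
have ij : (i < (i + j).+1)%N by rewrite ltnS leq_addr.
rewrite coefM (bigD1 (Ordinal ij)) //= addKn => -[d dE].
have [e eE] : divides c (\sum_(m < (i + j).+1 | m != Ordinal ij)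
    p`_m * q`_(i + j - m)).
  apply: big_ind => [|x y [x' ->] [y' ->]|m]; first by exists 0; rewrite mul0r.
    by exists (x' + y'); rewrite mulrDl.
  rewrite -val_eqE /= neq_ltn => /orP[mi|im].
    by rewrite mulrC; apply/divides_mull/pi.
  apply/divides_mull/qj; rewrite ltn_subLR ?ltn_add2r //.
  by rewrite -ltnS ltn_ord.
have /cP : divides c (p`_i * q`_j).
  by exists (d - e); rewrite mulrBl -dE eE addrK.
by case.
Qed.

Lemma prime_product_polyC c : prime_product c -> prime_product c%:P.
Proof.
elim=> [u uU|p a pP _ IH].
  by apply: prime_product_unit; rewrite rmorph_unit.
by rewrite polyCM; apply: prime_product_mul => //; apply: prime_polyC.
Qed.

(* [b] collects the prime factors of the leading coefficient already known
   not to divide [p]. *)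
Lemma primitive_part_rec l : prime_product l -> forall p (b : R),
    lead_coef p = b * l ->
    (forall c, prime_elt c -> divides c b -> ~ divides c%:P p) ->
  exists c q, p = c *: q /\ primitive_poly q.
Proof.
elim=> {l} [u uU|c l cP _ IH] p b pl bp.
  exists 1, p; rewrite scale1r; split=> // c cP cp; have [_ _ cprime] := cP.
  have : divides c (b * u) by rewrite -pl; apply: (polyC_divides _ _).1.
  by case/cprime => [/bp|/(prime_not_dvd_unit cP)]; apply.
have [cp|ncp] := pselect (divides c%:P p).
  have [q pE] := cp; rewrite mulrC mul_polyC in pE; have [c0 _ _] := cP.
  case: (IH q b) => [|e eP eb eq|d [r [qE rP]]].
  - apply: (mulfI c0); rewrite -lead_coefZ -pE pl mulrCA //.
  - by apply: (bp e) => //; rewrite pE -mul_polyC; apply: divides_mull.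
  by exists (c * d), r; rewrite -scalerA -qE.
apply: (IH p (b * c)) => [|e eP]; first by rewrite pl mulrA.
have [_ _ eprime] := eP; case/eprime => [|ec]; first exact: bp.
case: (prime_divides_sym eP cP ec) => d eE ep; apply: ncp.
by apply: divides_trans ep; exists d%:P; rewrite eE polyCM.
Qed.

Lemma primitive_part p : p != 0 -> exists c q, p = c *: q /\ primitive_poly q.
Proof.
rewrite -lead_coef_eq0 => /Rfact lP.
apply: (primitive_part_rec (b := 1) lP) => [|c cP c1]; first by rewrite mul1r.
by case: (prime_not_dvd_unit cP (unitr1 _)).
Qed.

(** A prime factor of [u] would divide the primitive polynomial [p]. *)
Lemma primitive_scale_unit u p q :
  primitive_poly p -> p != 0 -> p = u *: q -> u \is a GRing.unit.
Proof.
move=> pP p0 pE.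
have : prime_product u.
  by apply: Rfact; apply: contraNneq p0 => u0; rewrite pE u0 scale0r.
case E : _ / => [//|c a cP _]; case: (pP c cP).
by exists (a *: q); rewrite pE E [RHS]mulrC mul_polyC scalerA.
Qed.

(** Clearing denominators: the primes of [c] are cancelled one by one, each dividing [q] or [h]
    because it stays prime in R[X]. *)
Lemma scale_factor c : prime_product c -> forall p q h, c *: p = q * h ->
  exists u q1 v h1, [/\ q = u *: q1, h = v *: h1 & p = q1 * h1].
Proof.
elim=> [{}c cU|{}c a cP _ IH] p q h E.
  exists c, (c^-1 *: q), 1, h; rewrite scalerA divrr // !scale1r.
  by split=> //; rewrite -scalerAl -E scalerA mulVr // scale1r.
have [c0 _ _] := cP; have [_ _ cprime] := prime_polyC cP.
have cI := @mulfI _ c%:P; rewrite polyC_eq0 in cI.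
have : divides c%:P (q * h).
  by exists (a *: p); rewrite -E [RHS]mulrC mul_polyC scalerA.
case/cprime => -[r]; rewrite mulrC mul_polyC => rE.
  have E' : a *: p = r * h.
    by apply: (cI c0); rewrite !mul_polyC scalerA E rE scalerAl.
  have [u [q1 [v [h1 [rE' -> ->]]]]] := IH _ _ _ E'.
  by exists (c * u), q1, v, h1; rewrite -scalerA -rE'.
have E' : a *: p = q * r.
  by apply: (cI c0); rewrite !mul_polyC scalerA E rE scalerAr.
have [u [q1 [v [h1 [-> rE' ->]]]]] := IH _ _ _ E'.
by exists u, q1, (c * v), h1; rewrite -scalerA -rE'.
Qed.

(* [p %| a] is pseudo-divisibility, i.e. divisibility over the fraction
   field. *)
Lemma primitive_dvdp p a : primitive_poly p -> p != 0 -> p %| a -> divides p a.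
Proof.
move=> pP p0 /Pdiv.Idomain.dvdpP [[c q] /= c0 E].
have [u [q1 [v [h1 [_ pE ->]]]]] := scale_factor (Rfact c0) E.
have vU := primitive_scale_unit pP p0 pE.
exists (v^-1 *: q1); rewrite [in RHS]pE -scalerAl -scalerAr scalerA.
by rewrite mulVr // scale1r.
Qed.

(** Over the fraction field an irreducible polynomial is prime, by the Euclidean algorithm;
    primitivity brings the divisibility back to R. *)
Lemma prime_primitive_poly p : primitive_poly p -> (1 < size p)%N ->
    (forall a b, p = a * b -> size a = 1%N \/ size b = 1%N) ->
  prime_elt p.
Proof.
move=> pP p1 pirr; have p0 : p != 0 by rewrite -size_poly_gt0 ltnW.
(* Irreducibility over the fraction field: a factor there yields, after clearing denominators, a
   factorization over R, in which one factor is constant. *)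
have irr : irreducible_poly p.
  split=> // q q1 /Pdiv.Idomain.dvdpP [[c r] /= c0 E].
  have [u [r1 [v [h1 [rE qE pE]]]]] := scale_factor (Rfact c0) E.
  have : q * r != 0 by rewrite mulrC -E scale_poly_eq0 negb_or c0.
  rewrite mulf_eq0 negb_or qE scale_poly_eq0 negb_or => /andP[/andP[v0 h10] _].
  case: (pirr _ _ pE) => [/eqP/size_poly1P [d d0 r1E]|h11]; last first.
    by move: q1; rewrite qE size_scale // h11.
  rewrite pE r1E mul_polyC; apply/eqpP.
  by exists (d, v); rewrite /= ?d0 ?v0 // !scalerA mulrC.
split=> //; first by rewrite poly_unitE gtn_eqF.
move=> a b [c E]; have pab : p %| a * b by rewrite E dvdp_mull.
have [cpa|ncpa] := boolP (coprimep p a).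
  by right; apply: primitive_dvdp => //; rewrite -(Gauss_dvdpr _ cpa).
left; apply: primitive_dvdp => //.
have gp : gcdp p a %= p by apply: irr => //; apply: dvdp_gcdl.
by rewrite -(eqp_dvdl _ gp) dvdp_gcdr.
Qed.

(** The content factors in R. The primitive part is split, by induction on [size], into primitive
    polynomials without a factorization into two non-constant ones, and these are prime. *)
Theorem factorial_poly : factorial_ring {poly R}.
Proof.
have primP s : forall p, (size p <= s)%N -> p != 0 -> primitive_poly p ->
    prime_product p.
  elim: s => [|s IH] p; first by rewrite leqn0 size_poly_eq0 => ->.
  move=> ps p0 pP; have [p1|p1] := leqP (size p) 1.
    have pE := size1_polyC p1; apply: prime_product_unit.
    (* A primitive constant is a unit, being a scalar multiple of 1. *)
    have := primitive_scale_unit pP p0 (q := 1) (u := p`_0).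
    by rewrite alg_polyC -pE => /(_ erefl) uU; rewrite pE rmorph_unit.
  have [irr|/existsNP [a /existsNP [b /not_implyP [E /not_orP [a1 b1]]]]] :=
    pselect (forall a b, p = a * b -> size a = 1%N \/ size b = 1%N).
    rewrite -[p]mulr1; apply: prime_product_mul.
      exact: prime_primitive_poly.
    exact/prime_product_unit/unitr1.
  have [a0 b0] : a != 0 /\ b != 0 by apply/andP; rewrite -negb_or -mulf_eq0 -E.
  have sE : size p = (size a + size b).-1 by rewrite E size_mul.
  have sa : (1 < size a)%N.
    by rewrite ltn_neqAle size_poly_gt0 a0 andbT eq_sym; apply/eqP.
  have sb : (1 < size b)%N.
    by rewrite ltn_neqAle size_poly_gt0 b0 andbT eq_sym; apply/eqP.
  rewrite E; apply: prime_productM; apply: IH => //.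
  - rewrite -ltnS; apply: leq_trans ps; rewrite sE; move: sb.
    by case: (size b) => [//|[//|m _]]; rewrite addnS /= addnS ltnS leq_addr.
  - by move=> c cP ca; apply: (pP c cP); rewrite E mulrC; apply: divides_mull.
  - rewrite -ltnS; apply: leq_trans ps; rewrite sE; move: sa.
    by case: (size a) => [//|[//|m _]]; rewrite !addSn /= ltnS leq_addl.
  - by move=> c cP cb; apply: (pP c cP); rewrite E; apply: divides_mull.
move=> p p0; have [c [q [pE qP]]] := primitive_part p0.
have [c0 q0] : c != 0 /\ q != 0.
  by apply/andP; rewrite -negb_or -scale_poly_eq0 -pE.
rewrite pE -mul_polyC; apply: prime_productM.
  exact/prime_product_polyC/Rfact.
exact: (primP (size q)).
Qed.

End GaussLemma.

(** * Factoriality of polynomial rings in several variables *)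

Lemma factorial_iso (R S : idomainType) (f : {rmorphism R -> S})
    (h : S -> R) :
  cancel f h -> cancel h f -> factorial_ring S -> factorial_ring R.
Proof.
move=> fK hK Sfact a a0.
have fI := can_inj fK.
(* [h] is a bare map, but as the inverse of a ring morphism it is multiplicative, so it carries
   units and primes of S to those of R. *)
have hM x y : h (x * y) = h x * h y by apply: fI; rewrite rmorphM !hK.
have h1 : h 1 = 1 by apply: fI; rewrite rmorph1 hK.
have hU u : (h u \is a GRing.unit) = (u \is a GRing.unit).
  apply/unitrP/unitrP => -[v [vu uv]].
    by exists (f v); rewrite -(hK u) -!rmorphM vu uv rmorph1.
  by exists (h v); rewrite -!hM vu uv.
have hdiv x y : divides (h x) (h y) <-> divides x y.
  split=> [[c E]|[c ->]]; last by exists (h c); rewrite hM.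
  by exists (f c); apply: (can_inj hK); rewrite E hM fK.
rewrite -[a]fK; have /Sfact : f a != 0 by rewrite -(rmorph0 f) (inj_eq fI).
elim=> [u uU|p b [p0 pU pP] _ IH].
- by apply: prime_product_unit; rewrite hU.
rewrite hM; apply: prime_product_mul => //; split; last 1 first.
- by move=> x y; rewrite -[x]fK -[y]fK -hM !hdiv; apply: pP.
- by rewrite -(inj_eq fI) hK rmorph0.
by rewrite hU.
Qed.

Section UnivariateView.
Variables (n : nat) (R : idomainType).

Local Notation widen := (widen_ord (leqnSn n)).

Lemma mmultiE (q : {poly {mpoly R[n]}}) :
  mmulti q = (map_poly (@mwiden n R) q).['X_ord_max].
Proof. by rewrite /map_poly horner_poly. Qed.

(** [muni] reads a polynomial in n + 1 variables as one in the last variable, with coefficients in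
    the first n; [mmulti] substitutes the last variable back. It suffices to compare monomials. *)
Lemma muniK : cancel (@muni n R) (@mmulti n R).
Proof.
move=> p; rewrite muniE [RHS]mpolyE mmultiE rmorph_sum horner_sum.
apply: eq_bigr => m _; rewrite /= !map_polyZ hornerZ map_polyXn hornerXn.
rewrite /= mwidenZ mwidenX -scalerAl mpolyXn -mpolyXD.
congr (_ *: 'X_[_]); apply/mnmP => i.
rewrite mnmDE mulmnE mnm1E.
have [<-|im] := eqVneq ord_max i.
  by rewrite mnmwiden_ordmax mul1n.
have [i' ->] : exists i', i = widen i'.
  have i_lt : (i < n)%N.
    rewrite ltn_neqAle -ltnS ltn_ord andbT.
    by apply: contraNneq im => E; apply/eqP/val_inj.
  by exists (Ordinal i_lt); apply: val_inj.
by rewrite mnmwiden_widen mnmE addn0.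
Qed.

Lemma muniX m : muni 'X_[R, m]
  = 'X_[[multinom (m (widen i)) | i < n]] *: 'X^(m ord_max).
Proof. by rewrite muniE msuppX big_seq1 mcoeffX eqxx scale1r. Qed.

Lemma muni_mwiden (q : {mpoly R[n]}) : muni (mwiden q) = q%:P.
Proof.
rewrite {1}[q]mpolyE [X in _ = X%:P]mpolyE (raddf_sum (@mwiden n R)) !raddf_sum.
apply: eq_bigr => m _ /=; rewrite mwidenZ mwidenX muniZ muniX mnmwiden_ordmax.
rewrite expr0 scalerA mul_mpolyC alg_polyC; congr (_ *: 'X_[_])%:P.
by apply/mnmP => i; rewrite mnmE mnmwiden_widen.
Qed.

Lemma mmultiK : cancel (@mmulti n R) (@muni n R).
Proof.
move=> q; rewrite /mmulti rmorph_sum -[RHS]coefK poly_def.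
apply: eq_bigr => i _.
rewrite /= muniM muni_mwiden rmorphXn /= muniX mnm1E eqxx.
rewrite [X in 'X_[X]](_ : _ = 0%MM) ?mpolyX0 ?scale1r ?mul_polyC //.
by apply/mnmP => a; rewrite mnmE mnm1E mnm0E -val_eqE /= gtn_eqF.
Qed.

End UnivariateView.

Lemma factorial_mpoly (k : fieldType) n : factorial_ring {mpoly k[n]}.
Proof.
elim: n => [|n IH].
  move=> p p0; apply: prime_product_unit.
  have pE := nvar0_mpolyC p.
  rewrite pE rmorph_unit // unitfE; apply: contraNneq p0 => E.
  by rewrite pE E mpolyC0.
exact: factorial_iso (@muniK n k) (@mmultiK n k) (factorial_poly IH).
Qed.

(** * Values of polynomials and degrees of forms *)

Lemma meval_muni (k : fieldType) n (p : {mpoly k[n.+1]}) (v : 'I_n.+1 -> k) :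
  p.@[v] = (map_poly (meval (fun i => v (widen_ord (leqnSn n) i)))
              (muni p)).[v ord_max].
Proof.
rewrite muniE rmorph_sum horner_sum mevalE; apply: eq_bigr => m _.
rewrite /= !map_polyZ hornerZ map_polyXn hornerXn /= mevalZ mevalX.
rewrite big_ord_recr mulrA.
by congr (_ * _ * _); apply: eq_bigr => i _; rewrite mnmE.
Qed.

(** By induction on the number of variables: once the first n are fixed, every scalar is a root of
    the remaining univariate polynomial, which over an algebraically closed field must then be 0. *)
Lemma meval_eq0 (k : closedFieldType) n (p : {mpoly k[n]}) :
  (forall v, p.@[v] = 0) -> p = 0.
Proof.
elim: n p => [|n IH] p p0.
  rewrite [p]nvar0_mpolyC; have := p0 (fun=> 0).
  by rewrite {1}[p]nvar0_mpolyC mevalC => ->; rewrite mpolyC0.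
apply: (can_inj (@muniK n k)); rewrite muni0; apply/polyP => i; rewrite coef0.
apply: IH => v.
have : map_poly (meval v) (muni p) = 0.
  apply: contrapT => /eqP /closed_nonrootP [x /negP]; apply; apply/eqP.
  (* The point [v] extended by the last coordinate [x]. *)
  pose w (a : 'I_n.+1) := if unlift ord_max a is Some b then v b else x.
  rewrite -[RHS](p0 w) meval_muni /w unlift_none; congr (_.[_]).
  apply/polyP => l; rewrite !coef_map /=; apply: meval_eq => b.
  rewrite (_ : widen_ord _ b = lift ord_max b) ?liftK //.
  by apply: val_inj; rewrite /= /bump leqNgt ltn_ord.
by move=> /polyP/(_ i); rewrite coef_map coef0.
Qed.

Lemma homog_degree_le (k : fieldType) n (I : finType) (f F : I -> {mpoly k[n]})
    (d e : nat) :
    (forall i, f i \is d.-homog) -> (forall i, F i \is e.-homog) ->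
    (forall h, (forall i, exists q, f i = h * q) -> h \is a GRing.unit) ->
    (exists i, F i != 0) -> (forall i i', f i * F i' = f i' * F i) ->
  (d <= e)%N.
Proof.
move=> fd Fe f1 [i1 Fi1] E.
have f1' h : (forall i, divides h (f i)) -> h \is a GRing.unit.
  by move=> hf; apply: f1 => i; have [q ->] := hf i; exists q; rewrite mulrC.
have [i fi0] : exists i, f i != 0.
  apply: contrapT => nf.
  (* If all [f i] were 0, then 0 would be a common divisor. *)
  suff : (0 : {mpoly k[n]}) \is a GRing.unit by rewrite unitr0.
  apply: f1' => i; exists 0; rewrite mulr0; apply/eqP/negPn/negP => fi0.
  by apply: nf; exists i.
have [h FE] : divides (f i) (F i).
  exact: (coprime_family_divides f1' (factorial_mpoly fi0) (E i)).
have Fi0 : F i != 0.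
  apply: contraNneq Fi1 => Fi0; have /eqP := E i i1.
  by rewrite Fi0 mulr0 mulf_eq0 (negbTE fi0).
have h0 : h != 0 by apply: contraNneq Fi0 => h0; rewrite FE h0 mul0r.
(* A non-zero form is homogeneous of only one degree, and [msize] is that degree plus one. *)
have := dhomog_uniq Fi0 (Fe i) (dhomog_msize (Fe i)).
have := dhomog_uniq fi0 (fd i) (dhomog_msize (fd i)).
rewrite FE msizeM // => -> ->.
by rewrite (mpolySpred _ fi0) (mpolySpred _ h0) addSn addnS /= leq_addl.
Qed.

Lemma dhomog_prod_ord (k : fieldType) n r e (F : 'I_r -> {mpoly k[n]}) :
  (forall i, F i \is e.-homog) -> \prod_i F i \is (e * r).-homog.
Proof.
elim: r F => [|r IH] F Fe; first by rewrite big_ord0 muln0 dhomog1.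
by rewrite big_ord_recl mulnS; apply: dhomogM => //; apply: IH.
Qed.

Lemma dhomog_det (k : fieldType) n r e (A : 'M[{mpoly k[n]}]_r) :
  (forall i l, A i l \is e.-homog) -> \det A \is (e * r).-homog.
Proof.
move=> Ae; apply: rpred_sum => s _; rewrite mulr_sign.
by case: ifP => _; rewrite ?dhomogN; apply: dhomog_prod_ord.
Qed.

(** * Exterior products of vectors in a subspace *)

Section Wedge.
Variables (k : fieldType) (d : nat) (M : vectType k).

(** Expressing the [v a] in a basis of a subspace of dimension s factors each minor through k^s. For
    s < d it vanishes; for s = d it acquires the factor [\det C]. *)
Lemma wedge_comb s (C : 'M[k]_(d, s)) (b : 'I_s -> M) (v : 'I_d -> M)
    (I : ext_index d M) :
    (forall a, v a = \sum_l C a l *: b l) ->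
  wedge v I
  = \det (C *m \matrix_(l, i) coord (vbasis {:M}) (ext_col I i) (b l)).
Proof.
move=> vE; rewrite ffunE; congr (\det _); apply/matrixP => a i; rewrite !mxE vE.
by rewrite linear_sum; apply: eq_bigr => l _; rewrite linearZ mxE.
Qed.

Lemma coord_vbasis_mx (U : {vspace M}) (v : 'I_d -> M) :
    (forall a, v a \in U) ->
  forall a, v a
    = \sum_l (\matrix_(a, l) coord (vbasis U) l (v a)) a l *: (vbasis U)`_l.
Proof.
move=> vU a; rewrite {1}(coord_vbasis (vU a)).
by apply: eq_bigr => l _; rewrite mxE.
Qed.

Lemma wedge_small (U : {vspace M}) (v : 'I_d -> M) :
  (forall a, v a \in U) -> (\dim U < d)%N -> wedge v = 0.
Proof.
move=> vU dU; apply/ffunP => I.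
rewrite (wedge_comb I (coord_vbasis_mx vU)) [RHS]ffunE.
(* A non-zero minor would be a matrix of rank d factoring through dimension [\dim U]. *)
apply: contraTeq dU; rewrite -unitfE -[_ \is a _]/(_ \in unitmx) -leqNgt.
move=> /mxrank_unit {1}<-.
by apply: leq_trans (mxrankM_maxl _ _) (rank_leq_col _).
Qed.

Lemma ext_power_sum (u : ext_power d M) :
  u = \sum_(I : ext_index d M) u I *: ([ffun J => (I == J)%:R] : ext_power d M).
Proof.
apply/ffunP => J; rewrite sum_ffunE (bigD1 J) //= big1 ?addr0.
  by rewrite !ffunE eqxx [RHS]mulr1.
by move=> I IJ; rewrite !ffunE (negbTE IJ) [LHS]mulr0.
Qed.

End Wedge.

Lemma wedge_line (k : fieldType) d (M : vectType k) (U : Gr d M)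
    (v : 'I_d -> M) :
    (forall a, v a \in val U) ->
  wedge v \in <[wedge (fun a => (vbasis (val U))`_a)]>%VS.
Proof.
(* Substituting [\dim U] for [d] makes the coefficient matrix square; its determinant is the factor
   of proportionality. *)
case: U => U /= /eqP dU vU; case: _ / dU v vU => v vU.
apply/vlineP; exists (\det (\matrix_(a, l) coord (vbasis U) l (v a))).
apply/ffunP => I; rewrite (wedge_comb I (coord_vbasis_mx vU)).
by rewrite det_mulmx !ffunE.
Qed.

(** * Powers of a linear family of operators as matrices of forms *)

Section GenericPower.
Variables (k : fieldType) (W M : vectType k) (T : W -> 'End(M)).
Hypothesis T_lin : linear T.
HB.instance Definition _ := GRing.isLinear.Build k W 'End(M) *:%R T T_lin.

Local Notation eM := (vbasis {:M}).
Local Notation eW := (vbasis {:W}).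
Local Notation pow j w := (iter j (fun f => (T w \o f)%VF) \1%VF).
Local Notation point w := (fun a => coord eW a w).

(* Coordinates of [T w ^ j v], as polynomials in the coordinates of [w]. *)
Fixpoint pow_coord (j : nat) (v : M) (i : 'I_(\dim {:M})) :
    {mpoly k[\dim {:W}]} :=
  if j is j'.+1 then
    \sum_(a < \dim {:W}) \sum_(l < \dim {:M})
      coord eM i (T eW`_a eM`_l) *: ('X_a * pow_coord j' v l)
  else (coord eM i v)%:MP.

Lemma pow_coord_homog j v i : pow_coord j v i \is j.-homog.
Proof.
elim: j i => [|j IH] i /=.
  by rewrite -[_%:MP]mulr1 mul_mpolyC rpredZ ?dhomog1.
apply: rpred_sum => a _; apply: rpred_sum => l _; apply: rpredZ.
by rewrite -[j.+1]/(1 + j)%N; apply: dhomogM => //; rewrite dhomogX /= mdeg1.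
Qed.

Lemma pow_coord_eval j v i w :
  (pow_coord j v i).@[point w] = coord eM i (pow j w v).
Proof.
elim: j i => [|j IH] i /=; first by rewrite mevalC id_lfunE.
rewrite comp_lfunE; move: ((pow j w : 'End(M)) v) IH => u IH.
have -> : T w u = \sum_a \sum_l
    (coord eW a w * coord eM l u) *: T eW`_a eM`_l.
  rewrite {1}(coord_vbasis (memvf w)) [T _]linear_sum sum_lfunE.
  apply: eq_bigr => a _; rewrite linearZ scale_lfunE.
  rewrite {1}(coord_vbasis (memvf u)) linear_sum scaler_sumr.
  by apply: eq_bigr => l _; rewrite linearZ scalerA.
rewrite linear_sum raddf_sum; apply: eq_bigr => a _.
rewrite linear_sum raddf_sum; apply: eq_bigr => l _ /=.
by rewrite mevalZ mevalM mevalXU IH linearZ /= mulrC.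
Qed.

Variables (d j : nat) (v : 'I_d -> M).
Local Notation E := (ext_power d M).
Local Notation eE := (vbasis {:E}).

Definition wedge_poly (I : ext_index d M) : {mpoly k[\dim {:W}]} :=
  \det (\matrix_(a, b) pow_coord j (v a) (ext_col I b)).

(** The minors are coordinates in the basis e_I, whereas [is_degree] uses [vbasis {:E}]; this change
    of basis has scalar entries, so it preserves homogeneity. *)
Definition wedge_coord (i : 'I_(\dim {:E})) : {mpoly k[\dim {:W}]} :=
  \sum_I coord eE i ([ffun J => (I == J)%:R] : E) *: wedge_poly I.

Lemma wedge_coord_homog i : wedge_coord i \is (j * d).-homog.
Proof.
apply: rpred_sum => I _; apply: rpredZ; apply: dhomog_det => a b.
by rewrite mxE pow_coord_homog.
Qed.

Lemma wedge_coord_eval i w :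
  (wedge_coord i).@[point w] = coord eE i (wedge (fun a => pow j w (v a))).
Proof.
rewrite [wedge _]ext_power_sum [RHS]linear_sum [LHS]raddf_sum /=.
apply: eq_bigr => I _.
rewrite mevalZ linearZ /= mulrC; congr (_ * _).
rewrite ffunE /wedge_poly -det_map_mx; congr (\det _); apply/matrixP => a b.
by rewrite !mxE /= pow_coord_eval.
Qed.

End GenericPower.

(** * The operators x_M and the generic rank *)

Section ModuleOperators.
Import monalg.
Variables (k : fieldType) (p : nat) (g : vectType k) (L : restrictedLie p g).
Variables (M : vectType k) (X : renv_module L M).

Lemma mod_op_linear : linear (mod_op X).
Proof.
move=> a x y; rewrite /mod_op /renv_gen /env_gen.
rewrite (quot_pi_rel (lie_relD L _ _)) (quot_piD (lie_rel L)).
rewrite (quot_pi_rel (lie_relZ L _ _)).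
rewrite (quot_piD (@p_rel k p g L)) actD; congr (_ + _).
(* The scalar is turned into the ring element a 1, whose action is known from [act_scalar]. *)
rewrite -[free_gen x]mul1r scalerAl mul1r (quot_piM (lie_rel L)).
rewrite (quot_piM (@p_rel k p g L)).
by rewrite actM act_scalar -comp_lfunZl comp_lfun1l.
Qed.

HB.instance Definition _ :=
  GRing.isLinear.Build k g 'End(M) *:%R (mod_op X) mod_op_linear.

Lemma mod_powZ j c x : mod_pow X j (c *: x) = c ^+ j *: mod_pow X j x.
Proof.
elim: j => [|j IH]; first by rewrite expr0 scale1r.
rewrite -[LHS]/(mod_op X (c *: x) \o mod_pow X j (c *: x))%VF IH linearZ /=.
by rewrite -comp_lfunZl -comp_lfunZr scalerA exprS.
Qed.

Lemma rk_le_generic_rank j x :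
  nullcone L x -> (rk (mod_pow X j x) <= generic_rank X j)%N.
Proof.
move=> x0; have rM : (rk (mod_pow X j x) < (\dim {:M}).+1)%N.
  by rewrite ltnS dimvS ?subvf.
apply: (@leq_bigmax_cond _ _ (fun r : 'I__ => r : nat) (Ordinal rM)).
by apply/asboolP; exists x.
Qed.

(** Since 0 lies in V(g), the maximum runs over a non-empty set and is not the default 0. *)
Lemma generic_rank_attained j : nullcone L 0 ->
  exists2 x, nullcone L x & rk (mod_pow X j x) = generic_rank X j.
Proof.
move=> z0; rewrite /generic_rank.
pose P (r : 'I_(\dim {:M}).+1) :=
  `[< exists2 x, nullcone L x & rk (mod_pow X j x) = r >].
case: (@eq_bigmax_cond _ P (fun r : 'I__ => r : nat)) => [|r /asboolP rP ->] //.
apply/card_gt0P; have rM : (rk (mod_pow X j 0) < (\dim {:M}).+1)%N.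
  by rewrite ltnS dimvS ?subvf.
by exists (Ordinal rM); apply/asboolP; exists 0.
Qed.

End ModuleOperators.

Lemma limgZ (k : fieldType) (M : vectType k) (c : k) (f : 'End(M)) :
  c != 0 -> limg (c *: f) = limg f.
Proof.
move=> c0; apply/vspaceP => x; apply/memv_imgP/memv_imgP => -[y _ ->].
  by exists (c *: y); rewrite ?memvf // scale_lfunE linearZ.
exists (c^-1 *: y); rewrite ?memvf //.
by rewrite scale_lfunE linearZ scalerA divff // scale1r.
Qed.

(** * Comparison with a coprime representation of the Pluecker map *)

Section DegreeBound.
Variables (k : closedFieldType) (p : nat) (g : vectType k).
Variable (L : restrictedLie p g).
Variables (V : {vspace g}) (M : vectType k) (X : renv_module L M) (j : nat).
Hypothesis V_nullcone : [set x | x \in V]%classic = nullcone L.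

Local Notation W := (subvs_of V).
Local Notation r := (generic_rank X j).
Local Notation T := (fun w : W => mod_op X (vsval w)).

Lemma nullcone_vsval (w : W) : nullcone L (vsval w).
Proof. by rewrite -V_nullcone /=; apply: subvsP. Qed.

(** Two generators of a line differ by a scalar c != 0, and their j-th powers by c^j, which does not
    change the image. *)
Lemma limg_proj_rep (w : W) (l : Gr 1 W) : val l = <[w]>%VS ->
  limg (mod_pow X j (proj_rep l)) = limg (mod_pow X j (vsval w)).
Proof.
move=> lw; rewrite /proj_rep lw; have /vlineP [c cE] := memv_pick <[w]>%VS.
have c0 : c != 0.
  have : vpick <[w]>%VS != 0 by rewrite vpick0 -lw -dimv_eq0 (eqP (valP l)).
  by apply: contraNneq => c0; rewrite cE c0 scale0r.
by rewrite cE linearZ mod_powZ limgZ // expf_neq0.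
Qed.

Lemma is_degree_le d : (0 < j)%N -> (0 < r)%N ->
  is_degree (fun l : {l | max_locus X (V := V) j l} => plucker (image_map l)) d
  -> (d <= j * r)%N.
Proof.
move=> j0 r0 [f [fd f1 fphi]].
have [|x0 x0N rx0] := @generic_rank_attained _ _ _ _ _ X j.
  by rewrite -V_nullcone /= mem0v.
have [w0 w0E] : exists w0 : W, vsval w0 = x0.
  by exists (vsproj V x0); rewrite vsprojK //; move: x0N; rewrite -V_nullcone.
(* The v_a are preimages under x_0^j of a basis of its image. *)
have /fin_all_exists [v vE] (a : 'I_r) : exists v,
    mod_pow X j x0 v = (vbasis (limg (mod_pow X j x0)))`_a.
  have : (vbasis (limg (mod_pow X j x0)))`_a \in limg (mod_pow X j x0).
    by apply/vbasis_mem/mem_nth; rewrite size_tuple [X in (_ < X)%N]rx0.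
  by case/memv_imgP => v _ ->; exists v.
have T_lin : linear T by move=> c w w' /=; rewrite !linearP.
pose F := wedge_coord T j v.
have FE i w : (F i).@[fun a => coord (vbasis {:W}) a w]
    = coord (vbasis {:ext_power r M}) i
        (wedge (fun a => mod_pow X j (vsval w) (v a))).
  exact: wedge_coord_eval.
have Efree : free (vbasis {:ext_power r M}) by exact/basis_free/vbasisP.
apply: (@homog_degree_le _ _ _ f F) => //.
- by move=> i; apply: wedge_coord_homog.
(* The values of [F] at x_0 are the coordinates of the wedge of a basis, hence not all 0. *)
- apply: contrapT => nF.
  have U0P : \dim (limg (mod_pow X j x0)) == r by rewrite -rx0.
  have := wedge_vbasis_dim (mkGr U0P); rewrite /= dim_vline.
  suff -> : wedge (fun a : 'I_r => (vbasis (limg (mod_pow X j x0)))`_a) = 0.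
    by rewrite eqxx.
  rewrite [LHS](coord_vbasis (memvf _)) big1 // => i _.
  rewrite (_ : coord _ _ _ = 0) ?scale0r //.
  have := FE i w0; rewrite w0E (_ : F i = 0) ?meval0.
    by rewrite (funext vE) => <-.
  by apply: contrapT => /eqP Fi; apply: nF; exists i.
(* It remains to check f_i F_i' = f_i' F_i at each point z, which is the coordinate vector of some w
   in V. *)
move=> i i'; apply/eqP; rewrite -subr_eq0; apply/eqP/meval_eq0 => z.
pose w := \sum_a z a *: (vbasis {:W})`_a.
have zE : z =1 (fun a => coord (vbasis {:W}) a w).
  by move=> a; rewrite /w coord_sum_free //; exact/basis_free/vbasisP.
rewrite (meval_eq _ zE) mevalB !mevalM !FE.
set u := wedge _.
have [->|u0] := eqVneq u 0; first by rewrite !linear0 !mulr0 subrr.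
(* A smaller image could not contain r vectors with non-zero wedge. *)
have rw : rk (mod_pow X j (vsval w)) = r.
  apply/eqP; rewrite eqn_leq (rk_le_generic_rank X j (nullcone_vsval w)) /=.
  rewrite leqNgt; apply: contra u0 => rk_lt; apply/eqP.
  apply: (@wedge_small _ _ _ (limg (mod_pow X j (vsval w)))) => // a.
  by rewrite memv_img ?memvf.
(* As j > 0, the j-th power of the zero operator has rank 0 < r. *)
have w0' : w != 0.
  apply: contraTneq r0 => w0'; rewrite -rw w0' linear0.
  rewrite -[X in mod_pow _ _ X](scale0r 0) mod_powZ.
  by rewrite expr0n gtn_eqF // scale0r /rk lim0g dimv0.
have lP : \dim <[w]>%VS == 1%N by rewrite dim_vline w0'.
pose l : Gr 1 W := mkGr lP.
have lU : limg (mod_pow X j (proj_rep l)) = limg (mod_pow X j (vsval w)).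
  exact: limg_proj_rep.
have lmax : max_locus X j l by rewrite /max_locus /rk lU -/(rk _) rw.
pose y : {l | max_locus X j l} := exist (max_locus X j) l lmax.
(* The Pluecker line of im w^j contains [u] and is spanned by the vector with coordinates f_i(w), so
   the two are proportional. *)
have : u \in val (plucker (image_map y)).
  by apply: wedge_line => a; rewrite /= lU memv_img ?memvf.
rewrite (fphi y w erefl) => /vlineP [c ->].
rewrite !linearZ /= !coord_sum_free // mulrCA [X in _ - X]mulrCA.
by rewrite [X in _ - _ * X]mulrC subrr.
Qed.

End DegreeBound.

Local Close Scope ring_scope.

Theorem proposition4p1p1 (k : closedFieldType) (p : nat)
  (charkp : p \in [pchar k]%R) (g : vectType k) (L : restrictedLie p g)
  (V : {vspace g}) (V_nullcone : [set x | x \in V]%classic = nullcone L)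
  (M : vectType k) (X : renv_module L M) (j : nat) (hj : 1 <= j <= p.-1) :
  module_degree X V j <= j * generic_rank X j.
Proof.
(* For rank 0 and for the default value of [degree] the left side is 0. *)
rewrite /module_degree; case: eqVneq => // r0; rewrite /degree.
case: xgetP => // d _ dP; apply: is_degree_le dP => //.
- by case/andP: hj.
- by rewrite lt0n.
Qed.
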